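(* Let $H$ be a real Hilbert space with inner product $\langle\cdot,\cdot\rangle_H$ and norm $\|\cdot\|_H$, and let $A:D(A)\subset H\to 2^H$ be a maximal monotone operator such that $0\in A(0)$. Let $u:[0,\infty)\to H$ be a strong solution of $$u_t(t)+A(u(t))\ni 0\qquad\text{for a.e. } t>0 .$$ Assume that there exist constants $m>0$ and $\alpha>1$ such that $$\langle \xi,u\rangle_H \ge m\,\|u\|_H^{\alpha+1}\qquad \text{for all } u\in D(A) \text{ and all } \xi\in A(u).$$ Then the energy $E(t):=\frac12\|u(t)\|_H^2$ satisfies, for a.e. $t>0$, $$E'(t)+m\,2^{\frac{\alpha+1}{2}}\,E(t)^{\frac{\alpha+1}{2}}\le 0 .$$ In particular, there is a constant $C>0$ depending only on $\alpha$, $m$ and $E(0)$ such that, for all $t\ge 0$, $$E(t)\le\left(E(0)^{-\frac{\alpha-1}{2}}+\frac{\alpha-1}{2}\,m\,2^{\frac{\alpha+1}{2}}\,t\right)^{-\frac{2}{\alpha-1}}\le C(1+t)^{-\frac{2}{\alpha-1}} .$$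
   Context: A strong solution of $u_t+A(u)\ni 0$ is a continuous function $u:[0,\infty)\to H$, absolutely continuous on compact subintervals of $(0,\infty)$ (hence differentiable a.e.), with $u(t)\in D(A)$ and $-u_t(t)\in A(u(t))$ for a.e. $t>0$. If $E(0)=0$, the middle expression of the last chain of inequalities is understood as $0$. *)

(* Defs.v *)
From HB Require Import structures.
From mathcomp Require Import all_boot all_order all_algebra.
From mathcomp Require Import all_classical all_reals all_analysis.

Set Implicit Arguments.
Unset Strict Implicit.
Unset Printing Implicit Defensive.

Import Order.TTheory GRing.Theory Num.Theory.
Import numFieldNormedType.Exports.

Local Open Scope classical_set_scope.
Local Open Scope ring_scope.

(* A real Hilbert space is a complete normed module [H] together with a form
   [dot : {dot H for idfun}] (bilinear, symmetric, positive definite) such that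
   [hilbert_norm dot] holds. *)
Definition hilbert_norm (R : realType) (H : completeNormedModType R)
    (dot : {dot H for (@idfun R)}) : Prop :=
  forall x : H, `|x| ^+ 2 = dot x x.

(* A multivalued operator is a map [A : H -> set H]; its domain is the set of
   points where its value is nonempty. *)
Definition op_dom (T U : Type) (A : T -> set U) : set T :=
  [set x | A x !=set0].

Definition monotone_op (R : realType) (H : completeNormedModType R)
    (dot : {dot H for (@idfun R)}) (A : H -> set H) : Prop :=
  forall x y xi eta : H, A x xi -> A y eta -> 0 <= dot (xi - eta) (x - y).

Definition maximal_monotone (R : realType) (H : completeNormedModType R)
    (dot : {dot H for (@idfun R)}) (A : H -> set H) : Prop :=
  monotone_op dot A /\
  forall B : H -> set H,
    monotone_op dot B -> (forall x, A x `<=` B x) -> forall x, B x `<=` A x.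

Definition abs_continuous (R : realType) (V : normedModType R) (a b : R)
    (f : R -> V) : Prop :=
  forall e : R, 0 < e -> exists2 d : R, 0 < d &
    forall (n : nat) (x y : 'I_n -> R),
      (forall i, [/\ a <= x i, x i <= y i & y i <= b]) ->
      trivIset [set: 'I_n] (fun i => `]x i, y i[%classic) ->
      \sum_(i < n) (y i - x i) < d ->
      \sum_(i < n) `|f (y i) - f (x i)| < e.

(* Only the values of [u] on [0, +oo[ matter.  As [derive1 u] is total, with a
   default value where [u] has no derivative, the meaning of "-u_t(t) belongs to
   A(u(t))" includes the existence of the derivative at t. *)
Definition strong_solution (R : realType) (H : completeNormedModType R)
    (A : H -> set H) (u : R -> H) : Prop :=
  [/\ {within `[0, +oo[%classic, continuous u},
      (forall a b : R, 0 < a -> a <= b -> abs_continuous a b u) &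
      {ae (@lebesgue_measure R), forall t : R, 0 < t ->
         [/\ derivable u t 1, op_dom A (u t) & A (u t) (- derive1 u t)]}].

Definition energy (R : realType) (H : completeNormedModType R) (u : R -> H)
    (t : R) : R :=
  2^-1 * `|u t| ^+ 2.

(* For [e0 = 0] the intended value is 0; it has to be singled out because
   [powR] gives [0 `^ p = 0] for negative [p], instead of +oo. *)
Definition decay_bound (R : realType) (alpha m e0 t : R) : R :=
  if e0 == 0 then 0 else
  (e0 `^ (- ((alpha - 1) / 2)) +
     (alpha - 1) / 2 * m * 2 `^ ((alpha + 1) / 2) * t) `^ (- (2 / (alpha - 1))).

(* Main.v *)
Require Import Defs.
From HB Require Import structures.
From mathcomp Require Import all_boot all_order all_algebra.
From mathcomp Require Import all_classical all_reals all_analysis.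
From mathcomp Require Import measurable_realfun ring lra.

Import Order.TTheory GRing.Theory Num.Theory.
Import numFieldNormedType.Exports.

Local Open Scope classical_set_scope.
Local Open Scope ring_scope.

(** Where [u] is differentiable, [E' = <u', u>] ([is_derive_energy]).  Since
    [- u'] is in [A u], the coercivity of [A] reads [E' <= - m |u|^(alpha+1)].
    As [|u|^2 = 2 E], this is the differential inequality
    [E' + k E^(q+1) <= 0] with [k = m 2^((alpha+1)/2)] and [q = (alpha-1)/2].

    The decay comes from integrating this inequality, which only holds almost
    everywhere.  Dividing by [E^(q+1)], it says that [F = E^(-q)] has slope at
    least [q k]; hence [F t >= F 0 + q k t], and raising to the power [-1/q]
    gives the bound ([power_decay]).  Two points need care.  The function [E] is
    nonincreasing, so if [E t > 0] then [E] is bounded below by [E t] on [[0, t]]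
    and [F] is a Lipschitz function of [E] there, hence absolutely continuous on
    [[a, t]] for [a > 0].  At time 0 nothing is known beyond continuity, but the
    monotonicity of [E] gives [F 0 <= F a], so that it suffices to let [a] tend
    to 0 in [F 0 + q k (t - a) <= F t].

    What makes the almost-everywhere slopes integrate is absolute continuity:
    [abs_continuous_derive_le] states that a slope at most [c] almost everywhere
    bounds the increment by [c (b - a)].  The proof avoids the Lebesgue integral.
    The exceptional null set is covered by an open set of small measure, and
    [[a, b]] is cut into finitely many intervals, each of which is either small
    around a good point, where the increment is controlled by the derivative, or
    contained in the open set; absolute continuity makes the total increment
    over the latter negligible.

    For the last inequality, [e0^(-q) + q k t >= min(e0^(-q), q k) (1 + t)], which
    dictates the constant [C = min(e0^(-q), q k)^(-1/q)]. *)

(** * Increments of absolutely continuous functions *)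

(** Induction along a compact interval: a property that can be pushed across
    every point of [[a, b]] from one side to the other propagates from [a] to [b],
    since the supremum of the points reached can itself be crossed.  It replaces
    a tagged partition fine with respect to the gauge [s |-> d]. *)
Lemma interval_chaining {R : realType} (a b : R) (P : R -> Prop) :
  a <= b -> P a ->
  (forall s, a <= s <= b -> exists2 d : R, 0 < d & forall x y,
     a <= x <= s -> s <= y <= b -> s - d < x -> y < s + d -> P x -> P y) ->
  P b.
Proof.
move=> ab Pa step.
pose S := [set z | a <= z <= b /\ P z].
have Sa : S a by split=> //; rewrite lexx ab.
have Sb : ubound S b by move=> z [/andP[_ zb] _].
have hS : has_sup S by split; [exists a | exists b].
have a_s : a <= sup S by apply: ub_le_sup => //; exists b.
have s_b : sup S <= b by apply: ge_sup => //; exists a.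
have [d d0 stepd] := step (sup S) (introT andP (conj a_s s_b)).
have [x [/andP[ax xb] Px] dx] := sup_adherent d0 hS.
have xs : x <= sup S.
  by apply: ub_le_sup; [exists b | split=> //; rewrite ax xb].
have reach y : sup S <= y <= b -> y < sup S + d -> P y.
  by move=> sy yd; apply: (stepd x y) => //; rewrite ax xs.
case: (ltP b (sup S + d)) => [bd|db]; first by apply: reach => //; rewrite s_b lexx.
have /reach Py : sup S <= sup S + d / 2 <= b by apply/andP; split; lra.
have : sup S + d / 2 <= sup S.
  apply: ub_le_sup; first by exists b.
  split; last by apply: Py; lra.
  by apply/andP; split; lra.
by rewrite leNgt ltrDl divr_gt0.
Qed.

(** The two endpoints may lie on either side of [s]: splitting the increment at
    [s] turns it into two difference quotients with nonnegative weights. *)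
Lemma derivable_straddle {R : realType} (f : R -> R) (s c e : R) :
  derivable f s 1 -> derive1 f s <= c -> 0 < e ->
  exists2 d : R, 0 < d & forall x y, x <= s <= y -> s - d < x -> y < s + d ->
    f y - f x <= (c + e) * (y - x).
Proof.
move=> df dfc e0.
have /cvgrPdist_le /(_ e e0) : (fun h : R => h^-1 *: ((f \o shift s) (h *: (1 : R)) - f s)) @ 0^'
    --> derive1 f s by rewrite derive1E; exact: df.
move=> /nbhs_ballP[d /= d0 near_s]; exists d => // x y /andP[xs sy] dx yd.
have slope z : `|z - s| < d -> z != s ->
    `|derive1 f s - (z - s)^-1 * (f z - f s)| <= e.
  move=> zd zs; have := near_s (z - s).
  rewrite /ball /= sub0r normrN subr_eq0 => /(_ zd zs).
  by rewrite /shift /= -[(z - s) *: 1]/((z - s) * 1) mulr1 subrK.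
have right : f y - f s <= (c + e) * (y - s).
  have [->|ys] := eqVneq y s; first by rewrite !subrr mulr0.
  have ys0 : 0 < y - s by rewrite subr_gt0 lt_neqAle eq_sym ys.
  have := slope y; rewrite gtr0_norm // ys => /(_ _ isT) H.
  have /ler_normlP[H1 _] := H ltac:(lra).
  rewrite -ler_pdivrMr // mulrC; lra.
have left : f s - f x <= (c + e) * (s - x).
  have [->|xs'] := eqVneq x s; first by rewrite !subrr mulr0.
  have xs0 : 0 < s - x by rewrite subr_gt0 lt_neqAle xs'.
  have := slope x; rewrite distrC gtr0_norm // xs' => /(_ _ isT) H.
  have /ler_normlP[H1 _] := H ltac:(lra).
  rewrite -ler_pdivrMr // mulrC.
  have E : (x - s)^-1 * (f x - f s) = (s - x)^-1 * (f s - f x).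
    by rewrite -[x - s]opprB -[f x - f s]opprB invrN mulrNN.
  rewrite E in H1; lra.
lra.
Qed.

Lemma null_set_open_cover {R : realType} (N : set R) (e : R) :
  (@lebesgue_measure R).-negligible N -> 0 < e ->
  exists U : set R, [/\ open U, N `<=` U & (lebesgue_measure U < e%:E)%E].
Proof.
move=> [D [mD D0 ND]] e0.
have [|U [oU DU UD]] := @lebesgue_regularity_outer R D e mD _ e0.
  by rewrite [X in (X < _)%E]D0 ltry.
exists U; split=> //; first exact: subset_trans ND DU.
rewrite -(setDUK DU) measureU //.
- by rewrite [X in (X + _)%E]D0 add0e.
- by apply: measurableD => //; exact: open_measurable.
- by rewrite setDIK.
Qed.

Lemma sum_disjoint_itv_le {R : realType} (U : set R) (n : nat) (x y : 'I_n -> R) :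
  measurable U -> (forall i, x i <= y i) ->
  (forall i, `]x i, y i[ `<=` U) ->
  trivIset [set: 'I_n] (fun i => `]x i, y i[%classic) ->
  ((\sum_(i < n) (y i - x i))%:E <= lebesgue_measure U)%E.
Proof.
move=> mU xy sU tI.
rewrite -sumEFin.
have -> : (\sum_(i < n) (y i - x i)%:E =
    \sum_(i < n) lebesgue_measure (`]x i, y i[%classic : set R))%E.
  apply: eq_bigr => i _; rewrite lebesgue_measure_itv /= lte_fin.
  case: ltP => // yx.
  by have -> : y i = x i; [apply/le_anti; rewrite yx xy|rewrite subrr].
rewrite -measure_semi_additive_ord //; last exact: bigsetU_measurable.
apply: le_measure; rewrite ?inE //; first exact: bigsetU_measurable.
by elim/big_ind : _ => [z //|A B sA sB|i _]; [rewrite subUset|exact: sU].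
Qed.

(** Crossing a good point costs [(c + e)] times the length; crossing a bad one
    adds an interval to a finite disjoint family inside an open set of small
    measure.  The terms [`|c| * (y i - x i)] are there because [c] may be
    negative: they compensate the part [(c + e) * (y i - x i)] by which
    [(c + e) * (z - a)] then decreases along the intervals of the family. *)
Lemma abs_continuous_derive_le {R : realType} (a b c : R) (f : R -> R) :
  a <= b -> abs_continuous a b f ->
  {ae (@lebesgue_measure R), forall s, a <= s <= b ->
     derivable f s 1 /\ derive1 f s <= c} ->
  f b - f a <= c * (b - a).
Proof.
move=> ab acf; set good := fun s : R => _ => ae_good.
suff approx e : 0 < e -> f b - f a <= c * (b - a) + e * (b - a + 2).
  apply/ler_addgt0Pr => e e0.
  have ba2 : 0 < b - a + 2 by lra.
  have := approx (e / (b - a + 2)) (divr_gt0 e0 ba2).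
  by rewrite divfK ?gt_eqF.
move=> e0; have [d d0 small] := acf e e0.
have c1 : 0 < `|c| + 1 by rewrite ltr_wpDl.
(* The bound [e / (`|c| + 1)] makes the sum of the [`|c| * (y i - x i)] at most
   [e]. *)
have d'0 : 0 < Num.min d (e / (`|c| + 1)) by rewrite lt_min d0 divr_gt0.
have [U [oU badU Ud]] := null_set_open_cover _ _ ae_good d'0.
(* The family [x i, y i] collects the intervals spent on bad points so far. *)
pose covered z := exists (n : nat) (x y : 'I_n -> R),
  [/\ forall i, [/\ a <= x i, x i <= y i & y i <= z],
      forall i, `]x i, y i[ `<=` U,
      trivIset [set: 'I_n] (fun i => `]x i, y i[%classic) &
      f z - f a <= (c + e) * (z - a) +
        \sum_(i < n) (`|f (y i) - f (x i)| + `|c| * (y i - x i))].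
suff [n [x [y [xy sU tI fbfa]]]] : covered b.
  have : \sum_(i < n) (y i - x i) < Num.min d (e / (`|c| + 1)).
    rewrite -lte_fin; apply: le_lt_trans Ud.
    apply: sum_disjoint_itv_le => // [|i]; first exact: open_measurable.
    by case: (xy i).
  rewrite lt_min => /andP[/(small n x y xy tI) sume].
  rewrite ltr_pdivlMr // => cU.
  have U0 : 0 <= \sum_(i < n) (y i - x i).
    by apply: sumr_ge0 => i _; rewrite subr_ge0; case: (xy i).
  by move: fbfa; rewrite big_split /= -mulr_sumr; lra.
apply: (interval_chaining a) => //.
  exists 0, (fun=> a), (fun=> a); split=> [[]//|[]//|[]//|].
  by rewrite big_ord0 !subrr mulr0 addr0.
move=> s asb; have [gs|bs] := pselect (good s).
  have [dfs dfc] := gs asb.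
  have [r r0 fr] := derivable_straddle f s c e dfs dfc e0.
  exists r => // x y /andP[ax xs] /andP[sy yb] rx yr [n [p [q [pq sU tI fx]]]].
  exists n, p, q; split=> //.
    by move=> i; have [] := pq i; split=> //; lra.
  have := fr x y (introT andP (conj xs sy)) rx yr; lra.
have /nbhs_ballP[r /= r0 rU] : nbhs s U by apply: open_nbhs_nbhs; split=> //; exact: badU.
exists r => // x y /andP[ax xs] /andP[sy yb] rx yr [n [p [q [pq sU tI fx]]]].
(* The interval ]x, y[ becomes the member of index 0 of the new family. *)
pose ext z (g : 'I_n -> R) (i : 'I_n.+1) := if unlift ord0 i is Some j then g j else z.
have ext0 z g : ext z g ord0 = z by rewrite /ext unlift_none.
have extS z g j : ext z g (lift ord0 j) = g j by rewrite /ext liftK.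
exists n.+1, (ext x p), (ext y q); split.
- move=> i; case: (unliftP ord0 i) => [j|] ->; rewrite ?ext0 ?extS; last by split; lra.
  by have [] := pq j; split=> //; lra.
- move=> i; case: (unliftP ord0 i) => [j|] ->; rewrite ?ext0 ?extS; first exact: sU.
  move=> z /=; rewrite in_itv /= => /andP[xz zy]; apply: rU.
  by rewrite /ball /= ltr_norml; apply/andP; split; lra.
- move=> i j _ _ [z []] /=.
  case: (unliftP ord0 i) => [i'|] ->; case: (unliftP ord0 j) => [j'|] -> //;
    rewrite ?ext0 ?extS !in_itv /= => /andP[z1 z2] /andP[z3 z4].
  + by congr lift; apply: tI => //; exists z; split; rewrite /= in_itv /= ?z1 ?z3.
  + by have [_ _ ?] := pq i'; exfalso; lra.
  + by have [_ _ ?] := pq j'; exfalso; lra.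
- rewrite big_ord_recl !ext0.
  under eq_bigr do rewrite !extS.
  have := ler_norm (f y - f x).
  have cyx : - `|c| * (y - x) <= (c + e) * (y - x).
    by apply: ler_wpM2r; [lra|have := lerNnormlW (lexx `|c|); lra].
  lra.
Qed.

Lemma abs_continuous_dominated {R : realType} {V W : normedModType R}
    (a b M : R) (u : R -> V) (f : R -> W) :
  abs_continuous a b u -> 0 <= M ->
  (forall x y, a <= x <= b -> a <= y <= b -> `|f y - f x| <= M * `|u y - u x|) ->
  abs_continuous a b f.
Proof.
move=> acu M0 fu e e0.
have M1 : 0 < M + 1 by lra.
have [d d0 small] := acu _ (divr_gt0 e0 M1); exists d => // n x y xy tI xyd.
have := small n x y xy tI xyd; rewrite ltr_pdivlMr // mulrC.
apply: le_lt_trans; rewrite mulr_sumr; apply: ler_sum => i _.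
have [ax xiy yb] := xy i.
apply: (@le_trans _ _ (M * `|u (y i) - u (x i)|)).
  by apply: fu; apply/andP; split=> //; lra.
by apply: ler_wpM2r => //; lra.
Qed.

(** * A differential inequality of power type *)

(** For [z >= c] the derivative of [z^(-q)] is largest in absolute value at [c]. *)
Lemma powR_lipschitz {R : realType} (q c x y : R) :
  0 < q -> 0 < c -> c <= x -> c <= y ->
  `|y `^ (- q) - x `^ (- q)| <= q * c `^ (- q - 1) * `|y - x|.
Proof.
move=> q0 c0; wlog xy : x y / x <= y.
  move=> H cx cy; case: (leP x y) => [/H|/ltW /H]; first exact.
  by rewrite distrC (distrC y); exact.
move=> cx cy.
have pos z : z \in `[x, y] -> 0 < z by rewrite in_itv /= => /andP[? _]; lra.
have [||z zxy ->] := @MVT_segment R (fun z => z `^ (- q))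
    (fun z => - q * z `^ (- q - 1)) x y xy.
- by move=> z zxy; apply: is_derive1_powR; apply: pos; exact: subset_itv_oo_cc.
- apply: derivable_within_continuous => z /pos z0.
  by apply: derivable_powR; rewrite in_itv /= z0.
rewrite normrM normrM normrN (gtr0_norm q0) ger0_norm ?powR_ge0 //.
apply: ler_wpM2r => //; apply: ler_wpM2l; first exact: ltW.
rewrite -opprD !powRN lef_pV2 ?posrE ?powR_gt0 //; [|exact: pos].
apply: ge0_ler_powR; rewrite ?nnegrE; try lra.
  by apply/ltW/pos.
by move: zxy; rewrite in_itv /= => /andP[? _]; lra.
Qed.

Lemma lebesgue_ae_impl {R : realType} (P Q : R -> Prop) :
  (forall x, P x -> Q x) -> {ae (@lebesgue_measure R), forall x, P x} ->
  {ae (@lebesgue_measure R), forall x, Q x}.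
Proof.
move=> PQ.
exact: (@filterS _ _ (ae_filter_ringOfSetsType (@lebesgue_measure R))).
Qed.

(** Integration of [E' <= - k E^(q+1)].  Positivity of [E t] makes [E^(-q)]
    meaningful on all of [[0, t]]; when [E t = 0] there is nothing to bound. *)
Lemma power_decay {R : realType} (E : R -> R) (k q : R) :
  0 < k -> 0 < q -> (forall t, 0 <= E t) ->
  E s @[s --> 0^'+] --> E 0 ->
  (forall a b : R, 0 < a -> a <= b -> abs_continuous a b E) ->
  {ae (@lebesgue_measure R), forall t : R, 0 < t ->
     derivable E t 1 /\ derive1 E t + k * E t `^ (q + 1) <= 0} ->
  forall t, 0 < t -> 0 < E t ->
    0 < E 0 /\ E t <= (E 0 `^ (- q) + q * k * t) `^ (- q^-1).
Proof.
move=> k0 q0 E0 cE acE dE.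
have decr a b : 0 < a -> a <= b -> E b <= E a.
  move=> a0 ab; rewrite -subr_le0 -(mul0r (b - a)).
  apply: abs_continuous_derive_le => //; first exact: acE.
  apply: lebesgue_ae_impl dE => s dEs /andP[as_ sb].
  have [|dfs dle] := dEs; first lra.
  split=> //; have := mulr_ge0 (ltW k0) (powR_ge0 (E s) (q + 1)); lra.
have decr0 a : 0 < a -> E a <= E 0.
  move=> a0; apply: (cvgr_to_ge cE).
  near=> s; apply: decr; last by near: s; exact: nbhs_right_le.
  by near: s; exact: nbhs_right_gt.
move=> t t0 Et0; have E00 : 0 < E 0 by apply: lt_le_trans Et0 (decr0 t t0).
split=> //.
pose F s := E s `^ (- q).
have growth a : 0 < a -> a <= t -> F 0 + q * k * (t - a) <= F t.
  move=> a0 at_.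
  (* Absolute continuity is only available away from 0, so the first piece
     [[0, a]] is handled by monotonicity. *)
  have Fa : F 0 <= F a.
    rewrite /F !powRN lef_pV2 ?posrE ?powR_gt0 //; last first.
      by apply: lt_le_trans Et0 (decr _ _ a0 at_).
    by apply: ge0_ler_powR; rewrite ?nnegrE ?E0 //; [exact: ltW|exact: decr0].
  suff : - F t - - F a <= - (q * k) * (t - a) by lra.
  have pos s : a <= s <= t -> E t <= E s by case/andP=> as_ st; apply: decr => //; lra.
  apply: (abs_continuous_derive_le a t _ (fun s => - F s) at_).
    apply: (abs_continuous_dominated a t (q * E t `^ (- q - 1)) E).
    - exact: acE.
    - by rewrite mulr_ge0 ?powR_ge0 // ltW.
    - move=> x y xat yat; rewrite -opprD normrN.
      by apply: powR_lipschitz => //; exact: pos.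
  apply: lebesgue_ae_impl dE => s dEs ast.
  have s0 : 0 < s by case/andP: ast => ? _; lra.
  have Es0 : 0 < E s by apply: lt_le_trans Et0 (pos s ast).
  have [dfs dle] := dEs s0.
  have dF : is_derive s 1 (fun s => - F s) (q * E s `^ (- q - 1) * derive1 E s).
    have dE1 : is_derive s 1 E (derive1 E s) by rewrite derive1E; exact: derivableP.
    have dP := is_derive1_powR (- q) Es0.
    have := is_deriveN (is_derive1_comp dP dE1).
    by rewrite !mulNr opprK.
  split; first by case: dF.
  rewrite derive1E (@derive_val _ _ _ _ _ _ _ dF).
  have : q * E s `^ (- q - 1) * derive1 E s <= q * E s `^ (- q - 1) * (- (k * E s `^ (q + 1))).
    by apply: ler_wpM2l; [rewrite mulr_ge0 ?powR_ge0 // ltW|lra].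
  move=> /le_trans; apply.
  have -> : q * E s `^ (- q - 1) * (- (k * E s `^ (q + 1))) =
     - (q * k) * (E s `^ (- q - 1) * E s `^ (q + 1)) by ring.
  rewrite -powRD; last by rewrite (gt_eqF Es0) implybT.
  have -> : - q - 1 + (q + 1) = 0 by ring.
  by rewrite powRr0 mulr1.
have Ft : F 0 + q * k * t <= F t.
  apply/ler_addgt0Pr => e e0.
  have qk0 : 0 < q * k by rewrite mulr_gt0.
  have r0 : 0 < Num.min t (e / (q * k)) by rewrite lt_min t0 divr_gt0.
  have := growth _ r0; rewrite ge_min lexx => /(_ isT).
  have : q * k * Num.min t (e / (q * k)) <= e.
    by rewrite mulrC -ler_pdivlMr // ge_min lexx orbT.
  lra.
have base0 : 0 < F 0 + q * k * t by rewrite ltr_pwDl ?powR_gt0 // !mulr_ge0 // ltW.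
have -> : E t = F t `^ (- q^-1).
  by rewrite /F -powRrM mulrNN divff ?gt_eqF // powRr1.
have Ft0 : 0 < F t by apply: lt_le_trans base0 Ft.
rewrite -/(F 0) !(powRN _ q^-1) lef_pV2 ?posrE ?powR_gt0 //.
by apply: ge0_ler_powR => //; rewrite ?nnegrE ?invr_ge0; exact: ltW.
Unshelve. all: by end_near. Qed.

(** * The energy of a trajectory *)

Lemma dotC {R : realType} {H : completeNormedModType R}
    (dot : {dot H for (@idfun R)}) (x y : H) :
  dot x y = dot y x.
Proof. by rewrite hermC expr0 mul1r. Qed.

Lemma dot_polarization {R : realType} {H : completeNormedModType R}
    (dot : {dot H for (@idfun R)}) (x y : H) :
  hilbert_norm dot ->
  dot x y = 2^-1 * (`|x + y| ^+ 2 - `|x| ^+ 2 - `|y| ^+ 2).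
Proof.
by move=> hdot; rewrite !hdot linearDl !linearDr /= (dotC dot y x); field.
Qed.

(** By polarization, joint continuity of the inner product reduces to continuity
    of the norm. *)
Lemma cvg_dot {R : realType} {H : completeNormedModType R}
    (dot : {dot H for (@idfun R)}) (hdot : hilbert_norm dot)
    {T : Type} {F : set_system T} {FF : Filter F} (f g : T -> H) (a b : H) :
  f x @[x --> F] --> a -> g x @[x --> F] --> b ->
  dot (f x) (g x) @[x --> F] --> dot a b.
Proof.
move=> fa gb; rewrite dot_polarization //.
under eq_cvg do rewrite dot_polarization //.
have cvg_sqr (h : T -> H) c : h x @[x --> F] --> c -> `|h x| ^+ 2 @[x --> F] --> `|c| ^+ 2.
  by move=> hc; under eq_cvg do rewrite expr2; rewrite expr2; apply: cvgM; exact: cvg_norm.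
apply: cvgMr; apply: cvgB; last exact: cvg_sqr.
by apply: cvgB; apply: cvg_sqr => //; exact: cvgD.
Qed.

(** The difference quotient of [|u|^2] is [<(u(t+h) - u t)/h, u(t+h) + u t>], by
    symmetry of the inner product. *)
Lemma is_derive_energy {R : realType} {H : completeNormedModType R}
    (dot : {dot H for (@idfun R)}) (hdot : hilbert_norm dot)
    (u : R -> H) (t : R) :
  derivable u t 1 -> is_derive t 1 (energy u) (dot (derive1 u t) (u t)).
Proof.
move=> du.
have dq : h^-1 *: (u (h + t) - u t) @[h --> 0^'] --> derive1 u t.
  rewrite derive1E; move: du; rewrite /derivable => du.
  by under eq_cvg => h do rewrite -[X in X + t](mulr1 h : h *: (1 : R) = h).
have cs : u (h + t) + u t @[h --> 0^'] --> u t + u t.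
  apply: cvgD; last exact: cvg_cst.
  apply: cvg_within_filter; rewrite -[X in _ --> u X]add0r.
  apply: (@continuous_comp _ _ _ (fun h : R => h + t) u 0).
    by apply: cvgD; [exact: cvg_id|exact: cvg_cst].
  by rewrite add0r; apply: differentiable_continuous; apply/derivable1_diffP.
have lim : (fun h : R => h^-1 *: ((energy u \o shift t) (h *: (1 : R)) - energy u t)) @ 0^'
   --> dot (derive1 u t) (u t).
  have -> : dot (derive1 u t) (u t) = 2^-1 * dot (derive1 u t) (u t + u t).
    by rewrite linearDr /=; field.
  have -> : (fun h : R => h^-1 *: ((energy u \o shift t) (h *: (1 : R)) - energy u t)) =
    (fun h => 2^-1 * dot (h^-1 *: (u (h + t) - u t)) (u (h + t) + u t)).
    apply/funext => h /=.
    rewrite [h *: 1]mulr1 /energy /= !hdot linearZl_LR linearBl !linearDr /=.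
    by rewrite (dotC dot (u t) (u (h + t))) -[LHS]/(_ * _); ring.
  by apply: cvgMr; exact: (cvg_dot dot hdot) dq cs.
by split; [apply/cvg_ex; exists (dot (derive1 u t) (u t))|apply/cvg_lim].
Qed.

(** [|u|^2] is Lipschitz in [u] on bounded sets, and [u] is bounded on [[a, b]]. *)
Lemma abs_continuous_energy {R : realType} {H : completeNormedModType R}
    (u : R -> H) (a b : R) :
  a <= b -> {within `[a, b], continuous u} -> abs_continuous a b u ->
  abs_continuous a b (energy u).
Proof.
move=> ab cu acu.
have cnu : {within `[a, b], continuous (fun t => `|u t|)}.
  by move=> t; apply: cvg_norm; exact: cu.
have [c cab ubu] := EVT_max ab cnu.
apply: (abs_continuous_dominated a b `|u c| u) => // x y xab yab.
rewrite /energy -mulrBr subr_sqr normrM normrM.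
have nu : `|u x| <= `|u c| by apply: ubu; rewrite in_itv.
have nv : `|u y| <= `|u c| by apply: ubu; rewrite in_itv.
rewrite (ger0_norm (x := 2^-1)) // (ger0_norm (x := `|u y| + `|u x|)) ?addr_ge0 //.
rewrite mulrCA mulrC; apply: ler_pM => //.
- by lra.
- exact: ler_dist_dist.
Qed.

Theorem theorem3p3 (R : realType) :
  exists C : R -> R -> R -> R,
  forall (H : completeNormedModType R) (dot : {dot H for (@idfun R)})
    (hdot : hilbert_norm dot)
    (A : H -> set H) (hA : maximal_monotone dot A) (hA0 : A 0 0)
    (u : R -> H) (hu : strong_solution A u)
    (m alpha : R) (hm : 0 < m) (halpha : 1 < alpha)
    (hcoer : forall x : H, op_dom A x -> forall xi : H, A x xi ->
       m * `|x| `^ (alpha + 1) <= dot xi x),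
  {ae (@lebesgue_measure R), forall t : R, 0 < t ->
     derivable (energy u) t 1 /\
     derive1 (energy u) t
       + m * 2 `^ ((alpha + 1) / 2) * energy u t `^ ((alpha + 1) / 2) <= 0} /\
  0 < C alpha m (energy u 0) /\
  forall t : R, 0 <= t ->
    energy u t <= decay_bound alpha m (energy u 0) t /\
    decay_bound alpha m (energy u 0) t
      <= C alpha m (energy u 0) * (1 + t) `^ (- (2 / (alpha - 1))).
Proof.
pose rate alpha m : R := (alpha - 1) / 2 * m * 2 `^ ((alpha + 1) / 2).
(* For [e0 = 0] the bound is 0 and any positive constant will do. *)
exists (fun alpha m e0 => if e0 == 0 then 1 else
  Num.min (e0 `^ (- ((alpha - 1) / 2))) (rate alpha m) `^ (- (2 / (alpha - 1)))).
move=> H dot hdot A _ _ u [cu acu du] m alpha hm halpha hcoer.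
set k := m * 2 `^ ((alpha + 1) / 2); set q := (alpha - 1) / 2.
have q0 : 0 < q by rewrite divr_gt0 // subr_gt0.
have k0 : 0 < k by rewrite mulr_gt0 // powR_gt0.
have qE : 2 / (alpha - 1) = q^-1 by rewrite invf_div.
have pE : (alpha + 1) / 2 = q + 1 by rewrite /q; field.
have rateE : rate alpha m = q * k by rewrite /rate mulrA.
have [_ cu0] := (continuous_within_itvcyP 0 u).1 cu.
have e_ge0 t : 0 <= energy u t by rewrite mulr_ge0.
have diss : {ae (@lebesgue_measure R), forall t : R, 0 < t ->
    derivable (energy u) t 1 /\
    derive1 (energy u) t + k * energy u t `^ (q + 1) <= 0}.
  apply: lebesgue_ae_impl du => t dut t0.
  have [dut1 domt At] := dut t0.
  have dE := is_derive_energy dot hdot u t dut1.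
  split; first by case: dE.
  rewrite derive1E (@derive_val _ _ _ _ _ _ _ dE).
  have := hcoer _ domt _ At; rewrite linearNl /=.
  have -> : k * energy u t `^ (q + 1) = m * `|u t| `^ (alpha + 1).
    rewrite -pE /k -mulrA -powRM // /energy mulrA divff // mul1r.
    by rewrite -powR_mulrn // -powRrM; congr (_ * _ `^ _); field.
  by lra.
have cE : energy u s @[s --> 0^'+] --> energy u 0.
  apply: cvgMr; under eq_cvg do rewrite expr2; rewrite expr2.
  by apply: cvgM; apply: cvg_norm.
have acE a b : 0 < a -> a <= b -> abs_continuous a b (energy u).
  move=> a0 ab; apply: abs_continuous_energy => //; last exact: acu.
  apply: continuous_subspaceW cu => s /=; rewrite !in_itv /= => /andP[? _].
  by rewrite andbT; lra.
have decay t (t0 : 0 < t) (Et0 : 0 < energy u t) :=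
  power_decay (energy u) k q k0 q0 e_ge0 cE acE diss t t0 Et0.
split; first by rewrite pE.
have dpos e0 t : 0 < e0 -> 0 <= t -> 0 < e0 `^ (- q) + q * k * t.
  by move=> ? ?; rewrite ltr_pwDl ?powR_gt0 // mulr_ge0 // ltW // mulr_gt0.
rewrite /decay_bound -/q qE -(mulrA q m) -/k rateE.
split.
  case: ifPn => [_|e0]; first exact: ltr01.
  apply: powR_gt0; rewrite lt_min mulr_gt0 // andbT powR_gt0 //.
  by rewrite lt_neqAle eq_sym e0 e_ge0.
move=> t t_ge0; have [E0|E0_neq0] := eqVneq (energy u 0) 0.
  split; last by rewrite mul1r powR_ge0.
  move: t_ge0; rewrite le_eqVlt => /predU1P[<-|t0]; first by rewrite E0.
  rewrite leNgt; apply/negP => Et0.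
  by have [] := decay t t0 Et0; rewrite E0 ltxx.
have E0 : 0 < energy u 0 by rewrite lt_neqAle eq_sym E0_neq0 e_ge0.
have base0 := dpos _ _ E0 t_ge0; split.
  move: t_ge0; rewrite le_eqVlt => /predU1P[<-|t0].
    by rewrite mulr0 addr0 -powRrM mulrNN divff ?gt_eqF // powRr1.
  have [Et0|Et0] := ltP 0 (energy u t); first by case: (decay t t0 Et0).
  by apply: le_trans Et0 _; exact: powR_ge0.
set c := Num.min _ _.
have c0 : 0 < c by rewrite lt_min powR_gt0 // mulr_gt0.
have t1 : 0 < 1 + t by lra.
rewrite -(powRM _ (ltW c0) (ltW t1)) !(powRN _ q^-1) lef_pV2 ?posrE ?powR_gt0 ?mulr_gt0 //.
apply: ge0_ler_powR; rewrite ?nnegrE.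
- by rewrite invr_ge0 ltW.
- by rewrite ltW // mulr_gt0.
- exact: ltW.
rewrite mulrDr mulr1 lerD ?ge_min ?lexx //.
by apply: ler_wpM2r => //; rewrite ge_min lexx orbT.
Qed.
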